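(* Let $F,\beta:\mathbb{R}^3\to(0,+\infty)$ be functions, let $a_1,a_2,a_3$ be constants, and consider the isometric immersion $\varphi:(\mathbb{R}^2,g_0=\varphi^*h_0)\to(\mathbb{R}^3,h_0=F^{-2}(dx^2+dy^2+dz^2))$ with $\varphi(x,y)=(x,y,a_1x+a_2y+a_3)$. Let $h=\beta^{-2}h_0$. Then the conformal immersion $\varphi:(\mathbb{R}^2,f^{-1}\varphi^*h)\to(\mathbb{R}^3,h=\beta^{-2}h_0)$ is proper biharmonic if and only if $F\beta$ satisfies $$\begin{aligned} &\tfrac{1+2a_1^2+a_2^2}{1+a_1^2+a_2^2}\big[F\beta(F\beta)_{xx}-2((F\beta)_x)^2\big]+\tfrac{1+a_1^2+2a_2^2}{1+a_1^2+a_2^2}\big[F\beta(F\beta)_{yy}-2((F\beta)_y)^2\big]\\ &+\tfrac{2+a_1^2+a_2^2}{1+a_1^2+a_2^2}\big[F\beta(F\beta)_{zz}-2((F\beta)_z)^2\big]+\tfrac{2a_1a_2}{1+a_1^2+a_2^2}\big[F\beta(F\beta)_{xy}-2(F\beta)_x(F\beta)_y\big]\\ &-\tfrac{2a_1}{1+a_1^2+a_2^2}\big[F\beta(F\beta)_{xz}-2(F\beta)_x(F\beta)_z\big]-\tfrac{2a_2}{1+a_1^2+a_2^2}\big[F\beta(F\beta)_{yz}-2(F\beta)_y(F\beta)_z\big]=0 \end{aligned}$$ when restricted to the surface $z=a_1x+a_2y+a_3$, and $$f=\frac{c\sqrt{1+a_1^2+a_2^2}}{|-a_1(F\beta)_x-a_2(F\beta)_y+(F\beta)_z|}\circ\varphi$$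 for a constant $c>0$. Furthermore, the conformal factor is $\lambda=f^{1/2}$, and the surface $(\mathbb{R}^2,\varphi^*h)$ has mean curvature $H=\frac{-a_1(F\beta)_x-a_2(F\beta)_y+(F\beta)_z}{\sqrt{1+a_1^2+a_2^2}}$ (evaluated along the surface).
   Context: All functions are smooth and $f$ is a positive function on $\mathbb{R}^2$; subscripts $x,y,z$ denote partial derivatives. A map $\varphi:(M,g)\to(N,h)$ is harmonic if $\tau(\varphi)=\mathrm{Trace}_g\nabla d\varphi=0$, biharmonic if $\tau_2(\varphi)=\mathrm{Trace}_g(\nabla^\varphi\nabla^\varphi-\nabla^\varphi_{\nabla^M})\tau(\varphi)-\mathrm{Trace}_g R^N(d\varphi,\tau(\varphi))d\varphi=0$ with $R^N(X,Y)Z=[\nabla^N_X,\nabla^N_Y]Z-\nabla^N_{[X,Y]}Z$, and proper biharmonic if biharmonic but not harmonic. The conformal factor $\lambda$ of a conformal immersion $\varphi:(M,\bar g)\to(N,h)$ is the positive function with $\varphi^*h=\lambda^2\bar g$. The mean curvature is $H=\frac12\mathrm{trace}\,A$, $A(X)=-\nabla_X\xi$, with respect to the $h$-unit normal $\xi=F\beta\,\frac{-a_1\partial_x-a_2\partial_y+\partial_z}{\sqrt{1+a_1^2+a_2^2}}$. *)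

(* Defs.v *)
From HB Require Import structures.
From mathcomp Require Export all_boot all_order all_algebra.
From mathcomp Require Export all_classical all_reals all_analysis.
Set Implicit Arguments.
Unset Strict Implicit.
Unset Printing Implicit Defensive.
Import Order.TTheory GRing.Theory Num.Theory.
Import numFieldNormedType.Exports.
Local Open Scope ring_scope.

(* Riemannian geometry of R^n in its global chart.  Points and tangent vectors
   are row vectors; a metric is the matrix-valued function of its coefficients
   in the coordinate frame.  The operators below are total functions of
   arbitrary matrix fields; they have their geometric meaning when the fields
   are smooth, symmetric and positive definite. *)

Section Smooth.
Variables (R : realType) (n : nat).

Definition partial (i : 'I_n) (u : 'rV[R]_n -> R) : 'rV[R]_n -> R :=
  fun p => 'D_(delta_mx 0 i) u p.

(* C^oo: each iterated partial derivative is (Frechet) differentiable. *)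
Definition smooth (u : 'rV[R]_n -> R) : Prop :=
  forall (s : seq 'I_n) (p : 'rV[R]_n), differentiable (foldr partial u s) p.

End Smooth.

Section Connection.
Variables (R : realType) (n : nat).

Definition vfield : Type := 'rV[R]_n -> 'rV[R]_n.
Definition metric : Type := 'rV[R]_n -> 'M[R]_n.
Implicit Types (g : metric) (X Y Z : vfield).

Definition frame (i : 'I_n) : vfield := cst (delta_mx 0 i).

Definition inner g (p u v : 'rV[R]_n) : R := (u *m g p *m v^T) 0 0.

(* Gamma^k_ij *)
Definition christoffel g (p : 'rV[R]_n) (k i j : 'I_n) : R :=
  2^-1 * \sum_l invmx (g p) k l *
    (partial i (fun q => g q j l) p + partial j (fun q => g q i l) p
     - partial l (fun q => g q i j) p).

Definition Gamma g (p u v : 'rV[R]_n) : 'rV[R]_n :=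
  \row_k \sum_i \sum_j christoffel g p k i j * u 0 i * v 0 j.

(* Levi-Civita connection *)
Definition nabla g X Y : vfield :=
  fun p => 'D_(X p) Y p + Gamma g p (X p) (Y p).

Definition bracket X Y : vfield := fun p => 'D_(X p) Y p - 'D_(Y p) X p.

Definition curvature g X Y Z : vfield := fun p =>
  nabla g X (nabla g Y Z) p - nabla g Y (nabla g X Z) p
  - nabla g (bracket X Y) Z p.

(* R(u,v)w for tangent vectors at q: the curvature is tensorial, so any
   extension to vector fields may be used; we take the constant one. *)
Definition Riem g (q u v w : 'rV[R]_n) : 'rV[R]_n :=
  curvature g (cst u) (cst v) (cst w) q.

End Connection.

Section Maps.
Variables (R : realType) (m n : nat).
Variables (g : metric R m) (h : metric R n) (phi : 'rV[R]_m -> 'rV[R]_n).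

(* A section of phi^* T R^n is a function 'rV[R]_m -> 'rV[R]_n. *)

Definition dmap (X : vfield R m) : 'rV[R]_m -> 'rV[R]_n :=
  fun p => 'd phi p (X p).

(* nabla^phi, the connection of phi^* T R^n *)
Definition pull_nabla (X : vfield R m) (V : 'rV[R]_m -> 'rV[R]_n) :
    'rV[R]_m -> 'rV[R]_n :=
  fun p => 'D_(X p) V p + Gamma h (phi p) (dmap X p) (V p).

(* (nabla d phi)(X, Y) *)
Definition nabla_d (X Y : vfield R m) : 'rV[R]_m -> 'rV[R]_n :=
  fun p => pull_nabla X (dmap Y) p - dmap (nabla g X Y) p.

Definition trace_g (T : vfield R m -> vfield R m -> 'rV[R]_m -> 'rV[R]_n) :
    'rV[R]_m -> 'rV[R]_n :=
  fun p => \sum_i \sum_j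
    invmx (g p) i j *: T (frame i) (frame j) p.

Definition tension : 'rV[R]_m -> 'rV[R]_n := trace_g nabla_d.

Definition bitension : 'rV[R]_m -> 'rV[R]_n := fun p =>
  trace_g (fun X Y q => pull_nabla X (pull_nabla Y tension) q
                        - pull_nabla (nabla g X Y) tension q) p
  - trace_g (fun X Y q => Riem h (phi q) (dmap X q) (tension q) (dmap Y q)) p.

Definition harmonic : Prop := forall p, tension p = 0.
Definition biharmonic : Prop := forall p, bitension p = 0.
Definition proper_biharmonic : Prop := biharmonic /\ ~ harmonic.

Definition pullback : metric R m := fun p =>
  \matrix_(i, j) inner h (phi p) (dmap (frame i) p) (dmap (frame j) p).

Definition conformal_factor (lambda : 'rV[R]_m -> R) : Prop :=
  forall p, 0 < lambda p /\ pullback p = lambda p ^+ 2 *: g p.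

Definition unit_normal (xi : 'rV[R]_m -> 'rV[R]_n) : Prop :=
  forall p, inner h (phi p) (xi p) (xi p) = 1 /\
    forall X : vfield R m, inner h (phi p) (xi p) (dmap X p) = 0.

(* The endomorphism v |-> v *m A p of the tangent space at p is
   X |-> - nabla_X xi, tangent vectors to the surface being identified with
   vectors of the domain through d phi. *)
Definition shape_operator (xi : 'rV[R]_m -> 'rV[R]_n)
    (A : 'rV[R]_m -> 'M[R]_m) : Prop :=
  forall (X : vfield R m) p,
    dmap (fun q => X q *m A q) p = - pull_nabla X xi p.

End Maps.

(* The factor 1/2 is for surfaces. *)
Definition mean_curvature (R : realType) (n : nat) (h : metric R n)
    (phi : 'rV[R]_2 -> 'rV[R]_n) (xi : 'rV[R]_2 -> 'rV[R]_n)
    (H : 'rV[R]_2 -> R) : Prop :=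
  unit_normal h phi xi /\
  exists A : 'rV[R]_2 -> 'M[R]_2,
    shape_operator h phi xi A /\ forall p, H p = 2^-1 * \tr (A p).

Section Space.
Variable R : realType.

Definition vec3 (x y z : R) : 'rV[R]_3 := \row_(i < 3) [:: x; y; z]`_i.

Definition graph_plane (a1 a2 a3 : R) (p : 'rV[R]_2) : 'rV[R]_3 :=
  vec3 (p 0 0) (p 0 1) (a1 * p 0 0 + a2 * p 0 1 + a3).

Definition pdx (u : 'rV[R]_3 -> R) : 'rV[R]_3 -> R := partial (0 : 'I_3) u.
Definition pdy (u : 'rV[R]_3 -> R) : 'rV[R]_3 -> R := partial (1 : 'I_3) u.
Definition pdz (u : 'rV[R]_3 -> R) : 'rV[R]_3 -> R := partial (2 : 'I_3) u.

End Space.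

(* Main.v *)
Require Import Defs.
From mathcomp Require Import ring.
Import Order.TTheory GRing.Theory Num.Theory.
Import numFieldNormedType.Exports.
Set Implicit Arguments.
Unset Strict Implicit.
Unset Printing Implicit Defensive.
Local Open Scope ring_scope.

(* With s = F beta the ambient metric is h = s^-2 (dx^2 + dy^2 + dz^2), and the
   domain metric is w^-1 C with C the constant first fundamental form of the
   plane and w = f s^2.  The tension field is K s N, where N is the Euclidean
   normal and K = 2 f ds(N) / |N|^2.  The plane is umbilical, so in the
   bitension field the tangential contributions of the curvature and of the
   derivatives of ds(N) cancel, and what remains is, up to the factor w,
     (s Laplace_C K + (K / s) Q) N - 2 ds(N) dphi(grad_C K),
   Q being the left-hand side of the stated equation.  The tangential part
   forces ds(N) dK = 0, hence d(K^2) = 0 and K^2 is constant.  If the map is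
   not harmonic this constant is nonzero, so K itself is constant and the
   normal part reduces to Q = 0, while the constancy of K is the formula
   for f. *)

(** * Symmetry of second directional derivatives *)

Lemma dist_common {R : realType} (a b x y e : R) :
  x = y -> `|a - x| < e / 2 -> `|b - y| < e / 2 -> `|a - b| <= e.
Proof.
by move=> -> ax; rewrite distrC => yb; rewrite ltW// (@distm_lt_split _ _ y).
Qed.

Section Schwarz.
Context {R : realType} {V : normedModType R}.
Implicit Types (f : V -> R) (p u v : V) (t : R).

Lemma is_derive_line f p v t : derivable f (p + t *: v) v ->
  is_derive t (1 : R) (fun x : R => f (p + x *: v)) ('D_v f (p + t *: v)).
Proof.
have E : (fun h : R => h^-1 *: (((fun x => f (p + x *: v)) \o shift t) (h *: 1)
    - f (p + t *: v))) =
  (fun h => h^-1 *: ((f \o shift (p + t *: v)) (h *: v) - f (p + t *: v))).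
  apply/funext => h /=; congr (_ *: (f _ - _)).
  by rewrite [h%:A]mulr1 scalerDl addrCA.
by move=> dfv; apply: DeriveDef; rewrite /derivable /derive E.
Qed.

(** Two applications of the mean value theorem: first to the increment of [f] in direction [v] as a
    function along [u], then to ['D_u f] along [v]. The result is exact, with no remainder term. *)
Lemma second_difference f p u v t : 0 < t ->
  (forall q, derivable f q u) -> (forall q, derivable ('D_u f) q v) ->
  exists c d, [/\ 0 < c < t, 0 < d < t &
    f (p + t *: u + t *: v) - f (p + t *: u) - (f (p + t *: v) - f p) =
    'D_v ('D_u f) (p + c *: u + d *: v) * t ^+ 2].
Proof.
move=> t_gt0 dfu dfuv.
pose g x := f (p + t *: v + x *: u) - f (p + x *: u).
have dg x : is_derive (x : R) (1 : R) g
    ('D_u f (p + t *: v + x *: u) - 'D_u f (p + x *: u)).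
  by apply: is_deriveB; apply: is_derive_line.
have [|c cI gE] := MVT t_gt0 (fun x _ => dg x).
  apply: continuous_subspaceT => x.
  exact/differentiable_continuous/derivable1_diffP.
have de y : is_derive (y : R) (1 : R) (fun y : R => 'D_u f (p + c *: u + y *: v))
    ('D_v ('D_u f) (p + c *: u + y *: v)) by apply: is_derive_line.
have [|d dI eE] := MVT t_gt0 (fun y _ => de y).
  apply: continuous_subspaceT => x.
  exact/differentiable_continuous/derivable1_diffP.
exists c, d; split; [by move: cI; rewrite in_itv|by move: dI; rewrite in_itv|].
move: gE eE; rewrite /g !scale0r !addr0 !subr0 expr2 mulrA => gE <-.
by rewrite (addrAC p (c *: u)) -gE (addrAC p (t *: v)) opprB !addrA.
Qed.

(** The second difference of [f] is symmetric in [u] and [v], so the two mixed derivatives take a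
    common value at points (possibly different) as close to [p] as desired; continuity at [p]
    transfers the equality to [p]. *)
Lemma schwarz f p u v :
  (forall q, derivable f q u) -> (forall q, derivable f q v) ->
  (forall q, derivable ('D_u f) q v) -> (forall q, derivable ('D_v f) q u) ->
  {for p, continuous ('D_v ('D_u f))} -> {for p, continuous ('D_u ('D_v f))} ->
  'D_v ('D_u f) p = 'D_u ('D_v f) p.
Proof.
move=> dfu dfv dfuv dfvu /cvgrPdist_lt cuv /cvgrPdist_lt cvu.
apply/eqP; rewrite -subr_eq0 -normr_le0.
apply/ler_addgt0Pr => e e_gt0; rewrite add0r.
have e2 : 0 < e / 2 by rewrite divr_gt0.
have /nbhs_ballP[r /= r_gt0 near_p] : nbhs p (fun q =>
    `|'D_v ('D_u f) p - 'D_v ('D_u f) q| < e / 2 /\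
    `|'D_u ('D_v f) p - 'D_u ('D_v f) q| < e / 2).
  exact: (filterI (cuv _ e2) (cvu _ e2)).
have m_gt0 : 0 < 1 + `|u| + `|v| by rewrite -addrA ltr_pwDl ?addr_ge0.
(* With this [t] every increment [c *: u + d *: v] with [c] and [d] below [t] is shorter than [r];
   the summand 1 keeps the denominator positive and the bound strict even if [u] and [v] vanish. *)
pose t := r / (1 + `|u| + `|v|); have t_gt0 : 0 < t by rewrite divr_gt0.
have ballP c d : 0 < c < t -> 0 < d < t -> ball p r (p + c *: u + d *: v).
  move=> /andP[c_gt0 ct] /andP[d_gt0 dt].
  rewrite -ball_normE /= -addrA opprD addNKr normrN.
  rewrite (le_lt_trans (ler_normD _ _))// !normrZ !gtr0_norm//.
  apply: (@le_lt_trans _ _ (t * `|u| + t * `|v|)).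
    by rewrite lerD// ler_wpM2r// ltW.
  by rewrite -[ltRHS](divfK (lt0r_neq0 m_gt0)) -/t !mulrDr mulr1 -addrA ltr_pwDl.
have [c [d [cI dI E]]] := second_difference p t_gt0 dfu dfuv.
have [c' [d' [cI' dI' E']]] := second_difference p t_gt0 dfv dfvu.
have EE : 'D_v ('D_u f) (p + c *: u + d *: v) =
          'D_u ('D_v f) (p + d' *: u + c' *: v).
  apply: (mulIf (lt0r_neq0 (exprn_gt0 2 t_gt0))).
  rewrite (addrAC p (d' *: u)); apply: etrans (esym E) (etrans _ E').
  by rewrite (addrAC p (t *: v)); ring.
have [_ B] := near_p _ (ballP _ _ dI' cI').
exact: dist_common EE (near_p _ (ballP _ _ cI dI)).1 B.
Qed.

End Schwarz.

(** * Dot product, gradient and rules for directional derivatives *)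

Section Calculus.
Context {R : realType}.

Definition dot n (u v : 'rV[R]_n) : R := \sum_i u 0 i * v 0 i.

Definition grad n (u : 'rV[R]_n -> R) (q : 'rV[R]_n) : 'rV[R]_n :=
  \row_i partial i u q.

Lemma dotC n (u v : 'rV[R]_n) : dot u v = dot v u.
Proof. by apply: eq_bigr => i _; rewrite mulrC. Qed.

Lemma dotDl n (u v w : 'rV[R]_n) : dot (u + v) w = dot u w + dot v w.
Proof.
by rewrite /dot -big_split /=; apply: eq_bigr => i _; rewrite mxE mulrDl.
Qed.

Lemma dotZl n a (u w : 'rV[R]_n) : dot (a *: u) w = a * dot u w.
Proof. by rewrite /dot mulr_sumr; apply: eq_bigr => i _; rewrite mxE mulrA. Qed.

Lemma dotDr n (u v w : 'rV[R]_n) : dot u (v + w) = dot u v + dot u w.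
Proof. by rewrite dotC dotDl (dotC v) (dotC w). Qed.

Lemma dotZr n a (u w : 'rV[R]_n) : dot u (a *: w) = a * dot u w.
Proof. by rewrite dotC dotZl dotC. Qed.

Lemma dotNr n (u w : 'rV[R]_n) : dot u (- w) = - dot u w.
Proof. by rewrite -scaleN1r dotZr mulN1r. Qed.

Lemma dot_mulmx m n (u : 'rV[R]_m) (A : 'M[R]_(m, n)) (v : 'rV[R]_n) :
  dot (u *m A) v = (u *m A *m v^T) 0 0.
Proof. by rewrite [RHS]mxE; apply: eq_bigr => i _; rewrite [v^T _ _]mxE. Qed.

Lemma is_derive_lin n (u : 'rV[R]_n -> R) p v : differentiable u p ->
  is_derive p v u (dot (grad u p) v).
Proof.
move=> du; apply: DeriveDef; first exact: diff_derivable.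
rewrite deriveE// [v in LHS]row_sum_delta linear_sum; apply: eq_bigr => i _.
by rewrite linearZ mxE /partial deriveE// mulrC.
Qed.

Lemma derive_grad n (u : 'rV[R]_n -> R) p v : differentiable u p ->
  'D_v u p = dot (grad u p) v.
Proof. by move=> du; have := is_derive_lin v du => ?; rewrite derive_val. Qed.

Section Rules.
Context {V W : normedModType R}.
Implicit Types (a b : V -> R) (p v : V).

(** The rules speak of explicit functions of a point, so that the derivative of a compound
    expression is assembled by applying them to one another. *)
Lemma is_derive_add (A B : V -> W) p v dA dB :
  is_derive p v A dA -> is_derive p v B dB ->
  is_derive p v (fun q => A q + B q) (dA + dB).
Proof. exact: is_deriveD. Qed.

Lemma is_derive_opp (A : V -> W) p v dA :
  is_derive p v A dA -> is_derive p v (fun q => - A q) (- dA).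
Proof. exact: is_deriveN. Qed.

Lemma is_derive_mul a b p v da db :
  is_derive p v a da -> is_derive p v b db ->
  is_derive p v (fun q => a q * b q) (da * b p + a p * db).
Proof.
move=> Da Db; apply: (is_derive_eq (is_deriveM Da Db)).
by rewrite addrC; congr (_ + _); rewrite mulrC.
Qed.

Lemma is_derive_inv a p v da : a p != 0 -> is_derive p v a da ->
  is_derive p v (fun q => (a q)^-1) (- (a p) ^- 2 * da).
Proof.
move=> a0 [Da <-]; apply: DeriveDef; first exact: derivableV.
by rewrite deriveV.
Qed.

End Rules.

Lemma is_derive_row (V : normedModType R) m (A : V -> 'rV[R]_m) p v
    (dA : 'rV[R]_m) :
  (forall k, is_derive p v (fun q => A q 0 k) (dA 0 k)) -> is_derive p v A dA.
Proof.
move=> H; have DA : derivable A p v.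
  by apply/derivable_mxP => i k; rewrite ord1; have [] := H k.
apply: DeriveDef => //; rewrite derive_mx//; apply/rowP => k; rewrite mxE.
by have [] := H k.
Qed.

Lemma derive_row (V : normedModType R) m (A : V -> 'rV[R]_m) p v
    (dA : 'rV[R]_m) k :
  is_derive p v A dA -> is_derive p v (fun q => A q 0 k) (dA 0 k).
Proof.
case=> DA <-; have DAk := (derivable_mxP _ _ _).1 DA.
by apply: DeriveDef; [exact: DAk|rewrite derive_mx// mxE].
Qed.

Lemma is_derive_scale (V : normedModType R) m (a : V -> R)
    (A : V -> 'rV[R]_m) p v (da : R) (dA : 'rV[R]_m) :
  is_derive p v a da -> is_derive p v A dA ->
  is_derive p v (fun q => a q *: A q) (da *: A p + a p *: dA).
Proof.
move=> Da DA; apply: is_derive_row => k.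
rewrite (_ : (fun q => _) = (fun q => a q * A q 0 k)); last first.
  by apply/funext => q; rewrite mxE.
rewrite !mxE; apply: is_derive_mul => //; exact: derive_row.
Qed.

End Calculus.

(** * Closure properties of smooth functions *)

Section SmoothFunctions.
Context {R : realType}.

(** Smoothness graded by order: recursion on [k] permits induction for products, whose partial
    derivatives are sums of products rather than single products. Order 0 already includes
    differentiability. *)
Fixpoint Ck n k (u : 'rV[R]_n -> R) : Prop :=
  (forall p, differentiable u p) /\
  if k is l.+1 then forall i, Ck l (partial i u) else True.

(** [foldr partial] applies the last index of the list first, so the lists are taken apart from
    their end. *)
Lemma smoothP n (u : 'rV[R]_n -> R) : smooth u <-> forall k, Ck k u.
Proof.
split=> [su k|Cu s p].
  elim: k u su => [|k IH] u su; split=> //; try exact: (su [::]).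
  by move=> i; apply: IH => s p; rewrite -foldr_rcons; exact: su.
have [k sk] : exists k, (size s <= k)%N by exists (size s).
elim: k u s sk {Cu}(Cu k) => [|k IH] u s.
  by rewrite leqn0 size_eq0 => /eqP-> [du _]; exact: du.
case/lastP: s => [|s i]; first by move=> _ [du _]; exact: du.
by rewrite size_rcons ltnS foldr_rcons => sk [_ Cu]; apply: IH => //; exact: Cu.
Qed.

Lemma Ck_le n k (u : 'rV[R]_n -> R) : Ck k.+1 u -> Ck k u.
Proof.
elim: k u => [|k IH] u [du Cu]; split=> //= i.
exact: IH.
Qed.

Lemma partialD n (u v : 'rV[R]_n -> R) i :
  (forall p, differentiable u p) -> (forall p, differentiable v p) ->
  partial i (fun q => u q + v q) = fun q => partial i u q + partial i v q.
Proof.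
by move=> du dv; apply/funext => p; apply: deriveD; apply: diff_derivable.
Qed.

Lemma partialM n (u v : 'rV[R]_n -> R) i :
  (forall p, differentiable u p) -> (forall p, differentiable v p) ->
  partial i (fun q => u q * v q) =
    fun q => partial i u q * v q + u q * partial i v q.
Proof.
move=> du dv; apply/funext => p.
by have [] := is_derive_mul (is_derive_lin (delta_mx 0 i) (du p))
  (is_derive_lin (delta_mx 0 i) (dv p)); rewrite -!derive_grad.
Qed.

Lemma CkD n k (u v : 'rV[R]_n -> R) :
  Ck k u -> Ck k v -> Ck k (fun q => u q + v q).
Proof.
elim: k u v => [|k IH] u v [du Cu] [dv Cv];
  split=> [p|]; try exact: differentiableD; first by [].
by move=> i; rewrite partialD//; apply: IH; [exact: Cu|exact: Cv].
Qed.

Lemma CkM n k (u v : 'rV[R]_n -> R) :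
  Ck k u -> Ck k v -> Ck k (fun q => u q * v q).
Proof.
elim: k u v => [|k IH] u v Cu Cv; have [du Cu'] := Cu; have [dv Cv'] := Cv;
  split=> [p|]; try exact: differentiableM; first by [].
move=> i; rewrite partialM//.
by apply: CkD; apply: IH; do ?[exact: Ck_le|exact: Cu'|exact: Cv'].
Qed.

Lemma Ck_cst n k (c : R) : Ck k (fun _ : 'rV[R]_n => c).
Proof.
elim: k c => [|k IH] c; split=> [p|]; try exact: differentiable_cst; first by [].
move=> i; rewrite (_ : partial i _ = fun _ => 0)//; apply/funext => p.
exact: derive_cst.
Qed.

Lemma Ck_sum n m k (u : 'I_m -> 'rV[R]_n -> R) :
  (forall i, Ck k (u i)) -> Ck k (fun q => \sum_i u i q).
Proof.
elim: m u => [|m IH] u Cu.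
  rewrite (_ : (fun q => _) = fun _ => 0); first exact: Ck_cst.
  by apply/funext => q; rewrite big_ord0.
rewrite (_ : (fun q => _) =
    fun q => u ord0 q + \sum_i u (lift ord0 i) q); last first.
  by apply/funext => q; rewrite big_ord_recl.
by apply: CkD => //; apply: IH.
Qed.

Lemma smoothM n (u v : 'rV[R]_n -> R) :
  smooth u -> smooth v -> smooth (fun q => u q * v q).
Proof. by move=> /smoothP su /smoothP sv; apply/smoothP => k; apply: CkM. Qed.

Lemma smooth_diff n (u : 'rV[R]_n -> R) p : smooth u -> differentiable u p.
Proof. by move=> su; exact: (su [::]). Qed.

Lemma smooth_partial n (u : 'rV[R]_n -> R) i : smooth u -> smooth (partial i u).
Proof. by move=> su s p; rewrite -foldr_rcons; exact: su. Qed.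

(** A directional derivative is a combination of partial derivatives with constant coefficients. *)
Lemma smooth_derive n (u : 'rV[R]_n -> R) v : smooth u -> smooth ('D_v u).
Proof.
move=> su; rewrite (_ : 'D_v u = fun q => \sum_i v 0 i * partial i u q).
  apply/smoothP => k; apply: Ck_sum => i; apply: CkM; first exact: Ck_cst.
  by move: k; apply/smoothP; apply: smooth_partial.
apply/funext => q; rewrite derive_grad; last exact: smooth_diff.
by rewrite dotC; apply: eq_bigr => i _; rewrite mxE.
Qed.

Lemma smooth_schwarz n (u : 'rV[R]_n -> R) v w p : smooth u ->
  'D_v ('D_w u) p = 'D_w ('D_v u) p.
Proof.
move=> su; apply: schwarz => [q|q|q|q||]; try apply: diff_derivable;
  try apply: differentiable_continuous; apply: smooth_diff => //;
  do ?exact: smooth_derive; apply: smooth_derive; exact: smooth_derive.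
Qed.

(** * Composition with affine maps *)

Section AffineChange.
Variables (m n : nat) (M : 'M[R]_(m, n)) (b : 'rV[R]_n).

Lemma differentiable_affine p : differentiable (fun q => q *m M + b) p.
Proof.
rewrite (_ : (fun q => _) =
    (\sum_i (fun q : 'rV[R]_m => q 0 i *: row i M)) + cst b); last first.
  by apply/funext => q; rewrite mulmx_sum_row fctE fct_sumE.
apply: differentiableD => //; apply: differentiable_sum => i.
by apply: differentiableZl; exact: differentiable_coord.
Qed.

Lemma is_derive_affine p v : is_derive p v (fun q => q *m M + b) (v *m M).
Proof.
apply: DeriveDef; first exact/diff_derivable/differentiable_affine.
apply: cvg_lim => //; apply: cvg_near_cst.
near=> h; rewrite /= mulmxDl opprD addrACA subrr addr0 addrK -scalemxAl.
rewrite scalerA mulVf ?scale1r//; near: h; exact: nbhs_dnbhs_neq.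
Unshelve. all: by end_near. Qed.

Lemma diff_affine p v : 'd (fun q => q *m M + b) p v = v *m M.
Proof.
exact: etrans (esym (deriveE v (differentiable_affine p)))
  (@derive_val _ _ _ _ _ _ _ (is_derive_affine p v)).
Qed.

Lemma is_derive_comp_affine (u : 'rV[R]_n -> R) p v :
  differentiable u (p *m M + b) ->
  is_derive p v (fun q => u (q *m M + b)) ('D_(v *m M) u (p *m M + b)).
Proof.
move=> du; have dphi := differentiable_affine p.
have duphi := differentiable_comp dphi du.
apply: DeriveDef; first exact: diff_derivable.
by rewrite deriveE// diff_comp//= diff_affine deriveE.
Qed.

(** A partial derivative of the composite is the composite of a derivative of [u] in the fixed
    direction [w], so the induction stays among composites of smooth functions with the same affine
    map. *)
Lemma smooth_comp_affine (u : 'rV[R]_n -> R) :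
  smooth u -> smooth (fun q => u (q *m M + b)).
Proof.
move=> su; apply/smoothP => k; elim: k u su => [|k IH] u su;
  have d p : differentiable (fun q => u (q *m M + b)) p by
   apply: differentiable_comp; [exact: differentiable_affine|exact: smooth_diff].
  by split.
split=> // i; pose w : 'rV[R]_n := delta_mx 0 i *m M.
rewrite (_ : partial i _ = fun q => ('D_w u) (q *m M + b)); last first.
  apply/funext => q.
  have du : differentiable u (q *m M + b) by exact: smooth_diff.
  by have [] := is_derive_comp_affine (delta_mx 0 i) du.
exact: IH (smooth_derive w su).
Qed.

End AffineChange.
End SmoothFunctions.

Lemma sum_delta {R : realType} n (k : 'I_n) (F : 'I_n -> R) :
  \sum_i (k == i)%:R * F i = F k.
Proof.
rewrite (bigD1 k)//= eqxx mul1r big1 ?addr0// => i.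
by rewrite eq_sym => /negPf->; rewrite mul0r.
Qed.

(** * Levi-Civita connection of a metric conformal to a constant one *)

Section ConformalToConstant.
Context {R : realType} {n : nat} (C : 'M[R]_n).
Hypotheses (C_sym : C^T = C) (C_unit : C \in unitmx).
Variable w : 'rV[R]_n -> R.

(** This form covers both metrics in play: the ambient one, with [C] the identity, and the domain
    one, with [C] the first fundamental form of the plane. *)
Let g : metric R n := fun p => (w p)^-1 *: C.

Lemma partial_conformal p i j l : differentiable w p -> w p != 0 ->
  partial i (fun q => g q j l) p = - (w p) ^- 2 * partial i w p * C j l.
Proof.
move=> dw w0.
rewrite (_ : (fun q => _) = fun q => (w q)^-1 * C j l); last first.
  by apply/funext => q; rewrite mxE.
have Dw := is_derive_lin (delta_mx 0 i) dw.
have [_] := is_derive_mul (is_derive_inv w0 Dw) (is_derive_cst (C j l) p _).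
by rewrite /partial -derive_grad// => ->; rewrite mulr0 addr0.
Qed.

(** Only [w] is differentiated. In two of the three sums over [l] the inverse of [C] meets [C] and
    leaves a Kronecker delta; in the third it raises the index of dw. *)
Lemma christoffel_conformal p k i j : differentiable w p -> w p != 0 ->
  christoffel g p k i j = - (2 * w p)^-1 *
    ((k == j)%:R * partial i w p + (k == i)%:R * partial j w p
     - C i j * (grad w p *m invmx C) 0 k).
Proof.
move=> dw w0; rewrite /christoffel.
have C_symE a b : C a b = C b a by rewrite -[in LHS]C_sym mxE.
have Ci_sym a b : invmx C a b = invmx C b a.
  by rewrite -[in LHS]C_sym -trmx_inv mxE.
have CiC a b : \sum_l invmx C a l * C b l = (a == b)%:R.
  transitivity ((invmx C *m C) a b); last by rewrite mulVmx// mxE.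
  by rewrite mxE; apply: eq_bigr => l _; rewrite C_symE.
have gi : invmx (g p) = w p *: invmx C.
  by rewrite invmxZ ?invrK// unitmxZ// unitfE invr_eq0.
transitivity (2^-1 * \sum_l - (w p)^-1 *
    (invmx C k l * C j l * partial i w p + invmx C k l * C i l * partial j w p
     - C i j * (partial l w p * invmx C l k))).
  congr (_ * _); apply: eq_bigr => l _; rewrite !partial_conformal//.
  rewrite gi mxE.
  by rewrite [invmx C l k]Ci_sym; field.
rewrite -mulr_sumr sumrB big_split /= -!mulr_suml !CiC -mulr_sumr.
rewrite (_ : (grad w p *m _) 0 k =
    \sum_l partial l w p * invmx C l k); last first.
  by rewrite mxE; apply: eq_bigr => l _; rewrite mxE.
by field.
Qed.

Lemma Gamma_conformal p u v : differentiable w p -> w p != 0 ->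
  Gamma g p u v = - (2 * w p)^-1 *: (dot (grad w p) u *: v
    + dot (grad w p) v *: u - dot (u *m C) v *: (grad w p *m invmx C)).
Proof.
move=> dw w0; apply/rowP => k; rewrite !mxE; set X := (\sum_j _ in RHS).
transitivity (\sum_i \sum_j - (2 * w p)^-1 *
  (partial i w p * u 0 i * ((k == j)%:R * v 0 j)
   + (k == i)%:R * u 0 i * (partial j w p * v 0 j)
   - X * (u 0 i * C i j * v 0 j))).
  apply: eq_bigr => i _; apply: eq_bigr => j _.
  rewrite christoffel_conformal// [(_ *m _) 0 k]mxE -/X; ring.
transitivity (\sum_i - (2 * w p)^-1 *
  (partial i w p * u 0 i * v 0 k + (k == i)%:R * (u 0 i * dot (grad w p) v)
   - X * \sum_j (u 0 i * C i j * v 0 j))).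
  apply: eq_bigr => i _; rewrite -mulr_sumr sumrB big_split /= -!mulr_sumr.
  rewrite sum_delta mulrA; congr (_ * (_ + _ * _ - _)).
  by apply: eq_bigr => j _; rewrite mxE.
rewrite -mulr_sumr sumrB big_split /= -!mulr_suml sum_delta -mulr_sumr.
congr (_ * (_ * _ + _ - _)).
- by apply: eq_bigr => j _; rewrite mxE.
- by rewrite mulrC.
rewrite mulrC exchange_big; congr (_ * _); apply: eq_bigr => j _.
by rewrite -mulr_suml mxE.
Qed.

End ConformalToConstant.

(** * Connection and curvature of a conformally flat metric *)

Section ConformallyFlat.
Context {R : realType} {n : nat} (s : 'rV[R]_n -> R).
Hypotheses (s_smooth : smooth s) (s_neq0 : forall q, s q != 0).
Implicit Types u v z : 'rV[R]_n.

Definition conf_flat : metric R n := fun q => (s q ^+ 2)^-1 *: 1%:M.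
Local Notation h := conf_flat.

(** The case [C] = 1, w = s^2 of the previous formula; the gradient of s^2 is 2 s grad s, which
    turns the factor 1/(2 s^2) into 1/s. *)
Lemma Gamma_conf_flat q u v : Gamma h q u v = - (s q)^-1 *:
  ('D_u s q *: v + 'D_v s q *: u - dot u v *: grad s q).
Proof.
have ds : differentiable s q by exact: smooth_diff.
have s2 : grad (fun p => s p ^+ 2) q = (2 * s q) *: grad s q.
  apply/rowP => i; rewrite !mxE.
  have Ds := is_derive_lin (delta_mx 0 i) ds.
  by have [_] := is_derive_mul Ds Ds; rewrite -derive_grad// /partial => ->; ring.
have ds2 : differentiable (fun p => s p ^+ 2) q.
  exact: (smooth_diff q (smoothM s_smooth s_smooth)).
rewrite Gamma_conformal ?trmx1 ?unitmx1 ?expf_neq0//.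
rewrite s2 invmx1 !mulmx1 !derive_grad// !dotZl.
apply/rowP => k; rewrite !mxE; field.
exact: s_neq0.
Qed.

Lemma nabla_cst u v q : nabla h (cst u) (cst v) q = Gamma h q u v.
Proof. by rewrite /nabla derive_cst add0r. Qed.

(** In the gradient term, symmetry of second derivatives turns the derivative of grad s along [u]
    into the gradient of ['D_u s]. *)
Lemma derive_Gamma q u v z : is_derive q u (fun p => Gamma h p v z)
  ((s q ^- 2 * 'D_u s q) *:
      ('D_v s q *: z + 'D_z s q *: v - dot v z *: grad s q)
   - (s q)^-1 *: ('D_u ('D_v s) q *: z + 'D_u ('D_z s) q *: v
       - dot v z *: grad ('D_u s) q)).
Proof.
rewrite (_ : (fun p => _) = fun p => - (s p)^-1 *:
    ('D_v s p *: z + 'D_z s p *: v - dot v z *: grad s p)); last first.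
  by apply/funext => p; rewrite Gamma_conf_flat.
have D (a : 'rV[R]_n -> R) : smooth a -> is_derive q u a ('D_u a q).
  by move=> sa; rewrite derive_grad; [apply: is_derive_lin|]; apply: smooth_diff.
have Dg : is_derive q u (grad s) (grad ('D_u s) q).
  apply: is_derive_row => k; rewrite mxE.
  rewrite (_ : (fun p => grad s p 0 k) = 'D_(delta_mx 0 k) s); last first.
    by apply/funext => p; rewrite mxE.
  by rewrite /partial smooth_schwarz//; exact: D (smooth_derive _ s_smooth).
have Dd z' : is_derive q u ('D_z' s) ('D_u ('D_z' s) q).
  exact: D (smooth_derive _ s_smooth).
have Dm := is_derive_inv (s_neq0 q) (D _ s_smooth).
have Dc (y : 'rV[R]_n) := is_derive_cst y q u.
have DB := is_derive_add
  (is_derive_add (is_derive_scale (Dd v) (Dc z)) (is_derive_scale (Dd z) (Dc v)))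
  (is_derive_opp (is_derive_scale (is_derive_cst (dot v z) q u) Dg)).
apply: (is_derive_eq (is_derive_scale (is_derive_opp Dm) DB)).
by rewrite !scaler0 !addr0 scale0r add0r mulNr opprK scaleNr.
Qed.

Lemma Gamma0l q u : Gamma h q 0 u = 0.
Proof.
by apply/rowP => k; rewrite !mxE big1// => i _; rewrite big1// => j _;
  rewrite mxE mulr0 mul0r.
Qed.

(** Constant fields commute, so the curvature consists of two derivatives of [Gamma] and two
    iterated [Gamma] terms. Among the terms quadratic in first derivatives of [s], only those with
    |grad s|^2 survive. *)
Lemma Riem_conf_flat q u v z : Riem h q u v z =
  (s q)^-1 *: ('D_v ('D_z s) q *: u - 'D_u ('D_z s) q *: v
    + dot v z *: grad ('D_u s) q - dot u z *: grad ('D_v s) q)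
  - (dot (grad s q) (grad s q) / s q ^+ 2) *: (dot v z *: u - dot u z *: v).
Proof.
rewrite /Riem /curvature.
have nab v' z' : nabla h (cst v') (cst z') = fun p => Gamma h p v' z'.
  by apply/funext => p; rewrite nabla_cst.
have -> : bracket (cst u) (cst v) = cst 0.
  by apply/funext => p; rewrite /bracket !derive_cst subrr.
rewrite !nab Gamma0l subr0 /nabla /=.
have [_ ->] := derive_Gamma q u v z.
have [_ ->] := derive_Gamma q v u z.
have ds : differentiable s q by exact: smooth_diff.
have dG x y : 'D_(Gamma h q x y) s q = - (s q)^-1 *
    (2 * 'D_x s q * 'D_y s q - dot x y * dot (grad s q) (grad s q)).
  rewrite Gamma_conf_flat derive_grad// !(dotZr, dotDr, dotNr).
  by rewrite -!derive_grad//; ring.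
have dotG t x y : dot t (Gamma h q x y) = - (s q)^-1 *
    ('D_x s q * dot t y + 'D_y s q * dot t x - dot x y * 'D_t s q).
  rewrite Gamma_conf_flat !(dotZr, dotDr, dotNr).
  by rewrite (derive_grad t)// (dotC _ t); ring.
rewrite (Gamma_conf_flat q u (_ _ _ v z)) (Gamma_conf_flat q v (_ _ _ u z)).
rewrite !dG !dotG !Gamma_conf_flat.
rewrite (smooth_schwarz v u)// (dotC v u).
move: ('D_u s q) ('D_v s q) ('D_z s q) ('D_u ('D_z s) q) ('D_v ('D_z s) q).
move: ('D_u ('D_v s) q) (dot u v) (dot u z) (dot v z) (dot (grad s q) (grad s q)).
move=> a1 a2 a3 a4 a5 b1 b2 b3 b4 b5; apply/rowP => k; rewrite !mxE.
move: (partial k ('D_u s) q) (partial k ('D_v s) q) (partial k s q).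
move: (u 0 k) (v 0 k) (z 0 k) (s_neq0 q); move: (s q) => c c1 c2 c3 c0 c4 c5 c6.
by field.
Qed.

(** Allows the scalar K s to be taken out of the curvature term, the tension field being K s N.
    [Riem] is defined through constant fields, so homogeneity is read off from the closed
    formula. *)
Lemma RiemZ q u v z c : Riem h q u (c *: v) z = c *: Riem h q u v z.
Proof.
have DZ (a : 'rV[R]_n -> R) : smooth a -> 'D_(c *: v) a q = c * 'D_v a q.
  by move=> sa; rewrite !derive_grad ?dotZr//; exact: smooth_diff.
rewrite !Riem_conf_flat DZ; last exact: smooth_derive.
have -> : grad ('D_(c *: v) s) q = c *: grad ('D_v s) q.
  apply/rowP => k; rewrite !mxE /partial.
  rewrite !(smooth_schwarz (delta_mx 0 k))// DZ//; exact: smooth_derive.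
rewrite dotZl; move: (grad ('D_v s) q) (grad ('D_u s) q) => gv gu.
move: ('D_v ('D_z s) q) ('D_u ('D_z s) q) (dot (grad s q) (grad s q)).
by move=> d1 d2 d3; apply/rowP => k; rewrite !mxE; ring.
Qed.

End ConformallyFlat.

(** * Traces with respect to a constant matrix *)

Section WeightedTrace.
Context {R : realType} {m n : nat} (A : 'M[R]_m).
Implicit Types B : 'I_m -> 'I_m -> 'rV[R]_n.

(** Used with [A] the inverse of [C]; the trace for the metric w^-1 C is then [w] times this one. *)
Definition wtrace B : 'rV[R]_n := \sum_i \sum_j A i j *: B i j.

Lemma eq_wtrace B B' : (forall i j, B i j = B' i j) -> wtrace B = wtrace B'.
Proof.
by move=> BB'; apply: eq_bigr => i _; apply: eq_bigr => j _; rewrite BB'.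
Qed.

Lemma wtraceD B B' : wtrace (fun i j => B i j + B' i j) = wtrace B + wtrace B'.
Proof.
rewrite -big_split; apply: eq_bigr => i _ /=; rewrite -big_split.
by apply: eq_bigr => j _; rewrite scalerDr.
Qed.

Lemma wtraceZ c B : wtrace (fun i j => c *: B i j) = c *: wtrace B.
Proof.
rewrite /wtrace scaler_sumr; apply: eq_bigr => i _; rewrite scaler_sumr.
by apply: eq_bigr => j _; rewrite !scalerA mulrC.
Qed.

Lemma wtraceN B : wtrace (fun i j => - B i j) = - wtrace B.
Proof.
by rewrite -scaleN1r -wtraceZ; apply: eq_wtrace => i j; rewrite scaleN1r.
Qed.

Lemma wtrace_scale (a : 'I_m -> 'I_m -> R) (x : 'rV[R]_n) :
  wtrace (fun i j => a i j *: x) = (\sum_i \sum_j A i j * a i j) *: x.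
Proof.
rewrite scaler_suml; apply: eq_bigr => i _; rewrite scaler_suml.
by apply: eq_bigr => j _; rewrite scalerA.
Qed.

Lemma wtrace_mulmx (a : 'rV[R]_m) (X : 'M[R]_(m, n)) :
  wtrace (fun i j => a 0 i *: row j X) = a *m A *m X.
Proof.
rewrite mulmx_sum_row /wtrace exchange_big; apply: eq_bigr => j _ /=.
rewrite mxE scaler_suml; apply: eq_bigr => i _.
by rewrite scalerA mulrC.
Qed.

Lemma wtrace_sym B : A^T = A -> wtrace (fun i j => B j i) = wtrace B.
Proof.
move=> A_sym; rewrite [RHS]/wtrace exchange_big; apply: eq_bigr => i _.
by apply: eq_bigr => j _ /=; rewrite -[in RHS]A_sym mxE.
Qed.

End WeightedTrace.

Lemma sum_mul_trace {R : realType} m (A B : 'M[R]_m) :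
  \sum_i \sum_j A i j * B i j = \tr (A *m B^T).
Proof.
apply: eq_bigr => i _; rewrite mxE; apply: eq_bigr => j _; by rewrite mxE.
Qed.

Lemma trace_g_conformal {R : realType} m n (C : 'M[R]_m) (w : 'rV[R]_m -> R)
    (T : vfield R m -> vfield R m -> 'rV[R]_m -> 'rV[R]_n) p :
  C \in unitmx -> w p != 0 ->
  trace_g (fun q => (w q)^-1 *: C) T p =
  w p *: wtrace (invmx C) (fun i j => T (frame i) (frame j) p).
Proof.
move=> Cu w0; rewrite -wtraceZ; apply: eq_bigr => i _; apply: eq_bigr => j _.
rewrite invmxZ ?invrK ?unitmxZ ?unitfE ?invr_eq0// mxE scalerA mulrC.
by rewrite -scalerA scalerA.
Qed.

Section SurfaceTrace.
Context {R : realType} (C : 'M[R]_2).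
Hypotheses (C_sym : C^T = C) (C_unit : C \in unitmx).
Variable w : 'rV[R]_2 -> R.

(* This is the conformal invariance of harmonicity in dimension two. *)
Lemma wtrace_Gamma p : differentiable w p -> w p != 0 ->
  wtrace (invmx C) (fun i j =>
    Gamma (fun q => (w q)^-1 *: C) p (delta_mx 0 i) (delta_mx 0 j)) = 0.
Proof.
move=> dw w0; have Ci_sym : (invmx C)^T = invmx C by rewrite trmx_inv C_sym.
pose x := grad w p.
have dotd (y : 'rV[R]_2) l : dot y (delta_mx 0 l) = y 0 l.
  rewrite /dot -[RHS](sum_delta l (fun i => y 0 i)).
  by apply: eq_bigr => a _; rewrite mxE eqxx /= mulrC eq_sym.
transitivity (wtrace (invmx C) (fun i j => - (2 * w p)^-1 *:
  ((x 0 i *: row j 1%:M + x 0 j *: row i 1%:M) - C i j *: (x *m invmx C)))).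
  apply: eq_wtrace => i j; rewrite Gamma_conformal// !row1.
  by rewrite !dotd -rowE [row i C _ _]mxE.

rewrite wtraceZ wtraceD wtraceD wtraceN wtrace_scale.
rewrite (wtrace_sym (fun i j => x 0 i *: row j 1%:M))//.
rewrite wtrace_mulmx mulmx1 sum_mul_trace C_sym mulVmx// mxtrace1.
(* The two gradient terms add up to twice the raised gradient, and the trace of the identity in
   dimension two subtracts exactly the same. *)
by rewrite scaler_nat mulr2n subrr scaler0.
Qed.

End SurfaceTrace.

(** Restricted to the line through [p] and [q], the function has zero derivative. *)
Lemma grad0_constant {R : realType} n (u : 'rV[R]_n -> R) p q :
  smooth u -> (forall r, grad u r = 0) -> u p = u q.
Proof.
move=> su gu; pose l (x : R) := u (p + x *: (q - p)).
have Dl x : is_derive (x : R) (1 : R) l 0.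
  have dl := @diff_derivable _ _ _ _ _ (q - p)
    (smooth_diff (p + x *: (q - p)) su).
  apply: is_derive_eq (is_derive_line dl) _.
  rewrite derive_grad ?gu; last exact: smooth_diff.
  by rewrite /dot big1// => i _; rewrite mxE mul0r.
have := is_derive_0_is_cst 0 1 Dl.
by rewrite /l scale0r addr0 scale1r addrC subrK.
Qed.

Lemma grad_sqr {R : realType} n (u : 'rV[R]_n -> R) p : smooth u ->
  grad (fun q => u q * u q) p = (2 * u p) *: grad u p.
Proof.
move=> su; have du q : differentiable u q by exact: smooth_diff.
by apply/rowP => i; rewrite !mxE partialM//; ring.
Qed.

(** * Covariant derivatives and traces along an affine surface *)

Section AffineSurface.
Context {R : realType} {n : nat}.
Variables (s : 'rV[R]_n -> R) (M : 'M[R]_(2, n)) (b N : 'rV[R]_n).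
Hypotheses (s_smooth : smooth s) (s_neq0 : forall q, s q != 0).
Hypothesis normalN : forall v, dot (v *m M) N = 0.
Let C := M *m M^T.
Let D := dot N N.
Hypothesis C_unit : C \in unitmx.
(** The left-hand side is the Euclidean orthogonal projection onto the plane; the equation expresses
    that [N] alone accounts for the normal directions, i.e. codimension one. *)
Hypothesis tangent_proj :
  M^T *m invmx C *m M = 1%:M - D^-1 *: (N^T *m N).

Let h := conf_flat s.
Let phi (p : 'rV[R]_2) := p *m M + b.
Let E (i : 'I_2) : 'rV[R]_n := delta_mx 0 i *m M.

Lemma dmapE (X : vfield R 2) p : dmap phi X p = X p *m M.
Proof. exact: diff_affine. Qed.

Lemma pull_nablaE X (V : 'rV[R]_2 -> 'rV[R]_n) p : pull_nabla h phi X V p =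
  'D_(X p) V p + Gamma h (phi p) (X p *m M) (V p).
Proof. by rewrite /pull_nabla dmapE. Qed.

Lemma Gamma_r q u x y (c d : R) :
  Gamma h q u (c *: x + d *: y) = c *: Gamma h q u x + d *: Gamma h q u y.
Proof.
have ds : differentiable s q by exact: smooth_diff.
rewrite !Gamma_conf_flat// !derive_grad// !dotDr !dotZr.
by apply/rowP => k; rewrite !mxE; ring.
Qed.

Lemma pull_nabla_lin X (a c : 'rV[R]_2 -> R) (V W : 'rV[R]_2 -> 'rV[R]_n) p
    (da dc : R) :
  is_derive p (X p) a da -> is_derive p (X p) c dc ->
  derivable V p (X p) -> derivable W p (X p) ->
  pull_nabla h phi X (fun q => a q *: V q + c q *: W q) p =
    da *: V p + a p *: pull_nabla h phi X V p
    + (dc *: W p + c p *: pull_nabla h phi X W p).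
Proof.
move=> Da Dc DV DW; rewrite !pull_nablaE Gamma_r.
have [_ ->] := is_derive_add (is_derive_scale Da (derivableP DV))
  (is_derive_scale Dc (derivableP DW)).
by rewrite !scalerDr addrACA !addrA.
Qed.

Lemma pull_nabla_cst X (v : 'rV[R]_n) p :
  pull_nabla h phi X (cst v) p = Gamma h (phi p) (X p *m M) v.
Proof. by rewrite pull_nablaE derive_cst add0r. Qed.

Definition normal_derivative (p : 'rV[R]_2) : R := 'D_N s (phi p).
Local Notation nd := normal_derivative.

(** The factor [s] gives this normal field the constant [h]-length |N|, so that its covariant
    derivative is tangential. *)
Definition normal_section (p : 'rV[R]_2) : 'rV[R]_n := s (phi p) *: N.
Local Notation nu := normal_section.

Lemma smooth_nd : smooth nd.
Proof. exact: smooth_comp_affine (smooth_derive N s_smooth). Qed.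

Lemma is_derive_nu p v : is_derive p v nu ('D_(v *m M) s (phi p) *: N).
Proof.
have ds : differentiable s (phi p) by exact: smooth_diff.
have Ds : is_derive p v (fun q => s (phi q)) ('D_(v *m M) s (phi p)).
  exact: is_derive_comp_affine.
by apply: (is_derive_eq (is_derive_scale Ds (is_derive_cst N p v)));
   rewrite scaler0 addr0.
Qed.

(** The derivative of the factor [s] cancels against the normal part of [Gamma]. What is left is a
    multiple of the tangent vector itself: the plane is umbilical. *)
Lemma pull_nabla_nu X p :
  pull_nabla h phi X nu p = - nd p *: (X p *m M).
Proof.
rewrite pull_nablaE; have [_ ->] := is_derive_nu p (X p).
rewrite Gamma_conf_flat// /nu dotZr normalN mulr0 scale0r subr0.
have ds : differentiable s (phi p) by exact: smooth_diff.
rewrite (derive_grad (_ *: N))// dotZr -derive_grad// -/(nd p).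
have := s_neq0 (phi p); move: ('D_(X p *m M) s (phi p)) (s (phi p)) => c t t0.
by apply/rowP => k; rewrite !mxE; field.
Qed.

Lemma row_E i : row i M = E i.
Proof. by rewrite rowE. Qed.

Lemma C_sym : C^T = C.
Proof. by rewrite trmx_mul trmxK. Qed.

(** Contracting against the frame with the inverse of its Gram matrix is orthogonal projection, so
    [tangent_proj] applies. *)
Lemma wtrace_dotE (a : 'rV[R]_n) :
  wtrace (invmx C) (fun i j => dot a (E i) *: E j) = a - (dot a N / D) *: N.
Proof.
transitivity (wtrace (invmx C) (fun i j => (a *m M^T) 0 i *: row j M)).
  apply: eq_wtrace => i j; rewrite row_E; congr (_ *: _).
  by rewrite mxE; apply: eq_bigr => k _; rewrite -row_E !mxE.
rewrite wtrace_mulmx -!mulmxA (mulmxA M^T) tangent_proj mulmxBr mulmx1.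
rewrite -scalemxAr mulmxA; congr (_ - _); rewrite mulrC -scalerA; congr (_ *: _).
rewrite [a *m _]mx11_scalar mul_scalar_mx; congr (_ *: _).
by rewrite mxE; apply: eq_bigr => k _; rewrite mxE.
Qed.

Lemma wtrace_dotE_r (a : 'rV[R]_n) :
  wtrace (invmx C) (fun i j => dot a (E j) *: E i) = a - (dot a N / D) *: N.
Proof.
rewrite -wtrace_dotE; apply: (wtrace_sym (fun i j => dot a (E i) *: E j)).
by rewrite trmx_inv C_sym.
Qed.

Lemma dot_EE i j : dot (E i) (E j) = C i j.
Proof.
by rewrite -!row_E mxE; apply: eq_bigr => k _; rewrite !mxE.
Qed.

Lemma wtrace_first_form (x : 'rV[R]_n) :
  wtrace (invmx C) (fun i j => dot (E i) (E j) *: x) = 2 *: x.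
Proof.
rewrite wtrace_scale; congr (_ *: _).
under eq_bigr do under eq_bigr do rewrite dot_EE.
by rewrite sum_mul_trace C_sym mulVmx// mxtrace1.
Qed.

(** The two projected gradients of [s] meet minus twice the full gradient, the surface being
    two-dimensional; only the normal component lost in the projections remains. *)
Lemma wtrace_Gamma_h p :
  wtrace (invmx C) (fun i j => Gamma h (phi p) (E i) (E j)) =
  (2 * nd p / (s (phi p) * D)) *: N.
Proof.
have ds : differentiable s (phi p) by exact: smooth_diff.
transitivity (wtrace (invmx C) (fun i j => - (s (phi p))^-1 *:
  ((dot (grad s (phi p)) (E i) *: E j + dot (grad s (phi p)) (E j) *: E i)
   - dot (E i) (E j) *: grad s (phi p)))).
  by apply: eq_wtrace => i j; rewrite Gamma_conf_flat// !derive_grad.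
rewrite wtraceZ wtraceD wtraceD wtraceN wtrace_dotE wtrace_dotE_r.
rewrite wtrace_first_form -derive_grad// -/(nd p) invfM.
by apply/rowP => k; rewrite !mxE; ring.
Qed.

(** * The tension field *)

Variables (f : 'rV[R]_2 -> R).
Hypotheses (f_smooth : smooth f) (f_gt0 : forall p, 0 < f p).

Let w (p : 'rV[R]_2) : R := f p * s (phi p) ^+ 2.
Let g : metric R 2 := fun p => (w p)^-1 *: C.

Lemma w_smooth : smooth w.
Proof.
have ss : smooth (fun p => s (phi p)) by exact: smooth_comp_affine.
exact: smoothM f_smooth (smoothM ss ss).
Qed.

Lemma w_neq0 p : w p != 0.
Proof. exact: mulf_neq0 (lt0r_neq0 (f_gt0 p)) (expf_neq0 2 (s_neq0 _)). Qed.

Lemma nabla_frame i j p :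
  nabla g (frame i) (frame j) p = Gamma g p (delta_mx 0 i) (delta_mx 0 j).
Proof. by rewrite /nabla derive_cst add0r. Qed.

Lemma wtrace_Gamma_g p :
  wtrace (invmx C) (fun i j => nabla g (frame i) (frame j) p) = 0.
Proof.
transitivity (wtrace (invmx C) (fun i j =>
    Gamma g p (delta_mx 0 i) (delta_mx 0 j))).
  by apply: eq_wtrace => i j; exact: nabla_frame.
by apply: wtrace_Gamma; rewrite ?C_sym ?w_neq0//; exact: (smooth_diff p w_smooth).
Qed.

Lemma wtrace_lin k (L : 'M[R]_(2, k)) (B : 'I_2 -> 'I_2 -> 'rV[R]_2) :
  wtrace (invmx C) B = 0 ->
  wtrace (invmx C) (fun i j => B i j *m L) = 0.
Proof.
move=> B0; rewrite -(mul0mx _ L) -B0 /wtrace mulmx_suml; apply: eq_bigr => i _.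
by rewrite mulmx_suml; apply: eq_bigr => j _; rewrite scalemxAl.
Qed.

Definition tension_coef (p : 'rV[R]_2) : R := 2 / D * (f p * nd p).
Local Notation K := tension_coef.

Lemma smooth_tension_coef : smooth K.
Proof.
have sc : smooth (fun _ : 'rV[R]_2 => 2 / D) by apply/smoothP => k; exact: Ck_cst.
exact: smoothM sc (smoothM f_smooth smooth_nd).
Qed.

(** The vectors dphi(e_j) are constant, so the trace splits into an ambient part, which is normal,
    and a domain part, which vanishes by conformal invariance. *)
Lemma tension_surface : tension g h phi = fun p => K p *: nu p.
Proof.
apply/funext => p; rewrite /tension trace_g_conformal// ?w_neq0//.
transitivity (w p *: wtrace (invmx C) (fun i j =>
    Gamma h (phi p) (E i) (E j) - nabla g (frame i) (frame j) p *m M)).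
  congr (_ *: _); apply: eq_wtrace => i j; rewrite /nabla_d dmapE.
  rewrite (_ : dmap phi (frame j) = cst (E j)) ?pull_nabla_cst//.
  by apply/funext => q; rewrite dmapE.
rewrite wtraceD wtraceN wtrace_lin ?wtrace_Gamma_g// subr0 wtrace_Gamma_h.
rewrite /w /nu /K !scalerA; congr (_ *: _); have := s_neq0 (phi p).
rewrite [in _ / (_ * D)]invfM; move: (D^-1) (s (phi p)) => d t t0; field.
exact: t0.
Qed.


Lemma pull_nabla_scale X a (V : 'rV[R]_2 -> 'rV[R]_n) p (da : R) :
  is_derive p (X p) a da -> derivable V p (X p) ->
  pull_nabla h phi X (fun q => a q *: V q) p =
    da *: V p + a p *: pull_nabla h phi X V p.
Proof.
move=> Da DV.
rewrite (_ : (fun q => a q *: V q) = fun q => a q *: V q + cst 0 q *: V q).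
  rewrite (pull_nabla_lin Da (is_derive_cst 0 p (X p)) DV DV) /=.
  by rewrite !scale0r !addr0.
by apply/funext => q; rewrite scale0r addr0.
Qed.

Lemma pull_nabla_tension X p : pull_nabla h phi X (tension g h phi) p =
  'D_(X p) K p *: nu p + - (K p * nd p) *: (X p *m M).
Proof.
have DK := @diff_derivable _ _ _ _ _ (X p) (smooth_diff p smooth_tension_coef).
have [Dnu _] := is_derive_nu p (X p).
rewrite tension_surface (pull_nabla_scale (derivableP DK) Dnu) pull_nabla_nu.
by rewrite (scalerA (K p) (- nd p)) mulrN.
Qed.

(** * Second covariant derivatives and the bitension field *)

Lemma pull_nabla2_regroup (a c d e t : R) (x y z v : 'rV[R]_n) :
  a *: x + c *: (- d *: y) + (- e *: z + - t *: v) =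
  a *: x - (c * d) *: y - e *: z - t *: v.
Proof. by rewrite scalerA mulrN !scaleNr !addrA. Qed.

(** The vector dual to Hess s(N, .), since [N] is constant. *)
Definition hessN p : 'rV[R]_n := grad ('D_N s) (phi p).

Lemma pull_nabla2_tension i j p :
  pull_nabla h phi (frame i) (pull_nabla h phi (frame j) (tension g h phi)) p =
  partial i (partial j K) p *: nu p - (partial j K p * nd p) *: E i
  - (partial i K p * nd p + K p * dot (hessN p) (E i)) *: E j
  - (K p * nd p) *: Gamma h (phi p) (E i) (E j).
Proof.
have sK := smooth_tension_coef.
have D1 (a : 'rV[R]_2 -> R) : smooth a ->
    is_derive p (delta_mx 0 i) a (partial i a p).
  by move=> sa; exact: derivableP (diff_derivable (smooth_diff p sa)).
have DN : partial i nd p = dot (hessN p) (E i).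
  have dN : differentiable ('D_N s) (phi p).
    exact: smooth_diff (smooth_derive N s_smooth).
  have [_] := is_derive_comp_affine (delta_mx 0 i) dN.
  by rewrite /partial /nd => ->; rewrite derive_grad.
rewrite (_ : pull_nabla h phi (frame j) (tension g h phi) =
    fun q => partial j K q *: nu q + - (K q * nd q) *: cst (E j) q).
  have Dj := D1 _ (smooth_partial j sK).
  have DKn := is_derive_opp (is_derive_mul (D1 _ sK) (D1 _ smooth_nd)).
  have [Dnu _] := is_derive_nu p (delta_mx 0 i).
  rewrite (pull_nabla_lin Dj DKn Dnu (derivable_cst _ _ _)).
  rewrite pull_nabla_nu pull_nabla_cst DN /=.
  exact: pull_nabla2_regroup.
by apply/funext => q; rewrite pull_nabla_tension.
Qed.

(** The trace of Hess s over the plane is the full Laplacian minus the normal contribution. Each row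
    [H l] of the Hessian is projected onto the plane and the diagonal coordinates are summed. *)
Lemma wtrace_hess p (x : 'rV[R]_n) :
  wtrace (invmx C) (fun i j => 'D_(E i) ('D_(E j) s) (phi p) *: x) =
  (\sum_l partial l (partial l s) (phi p) - dot (hessN p) N / D) *: x.
Proof.
set q := phi p; pose H l := grad (partial l s) q.
have hE u v : 'D_u ('D_v s) q = \sum_l dot (H l) u * v 0 l.
  rewrite smooth_schwarz// derive_grad; last first.
    exact: smooth_diff (smooth_derive u s_smooth).
  apply: eq_bigr => l _; congr (_ * _); rewrite mxE /partial smooth_schwarz//.
  by rewrite derive_grad//; exact: smooth_diff (smooth_partial l s_smooth).
rewrite wtrace_scale; congr (_ *: _).
transitivity (\sum_l wtrace (invmx C) (fun i j => dot (H l) (E i) *: E j) 0 l).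
  under eq_bigr do under eq_bigr do rewrite hE mulr_sumr.
  under eq_bigr do rewrite exchange_big.
  rewrite exchange_big; apply: eq_bigr => l _; rewrite summxE.
  apply: eq_bigr => i _; rewrite summxE; apply: eq_bigr => j _.
  by rewrite !mxE.
under eq_bigr do rewrite wtrace_dotE !mxE.
rewrite sumrB; congr (_ - _).
transitivity ('D_N ('D_N s) q / D).
  by rewrite hE mulr_suml; apply: eq_bigr => l _; rewrite mulrAC.
congr (_ / _).
exact: derive_grad (smooth_diff q (smooth_derive N s_smooth)).
Qed.

(** Terms containing the product of [N] with a tangent vector vanish; the multiples of Hess s(N, N)
    coming from the projection and from the trace of the Hessian cancel. *)
Lemma wtrace_Riem p :
  wtrace (invmx C) (fun i j => Riem h (phi p) (E i) N (E j)) =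
  - (s (phi p))^-1 *: (hessN p
      + (\sum_l partial l (partial l s) (phi p)) *: N)
  + (2 * (dot (grad s (phi p)) (grad s (phi p)) / s (phi p) ^+ 2)) *: N.
Proof.
set c := dot _ _ / _.
have NE j : dot N (E j) = 0 by rewrite dotC normalN.
transitivity (wtrace (invmx C) (fun i j => (s (phi p))^-1 *:
   ((dot (hessN p) (E j) *: E i - 'D_(E i) ('D_(E j) s) (phi p) *: N)
    - dot (E i) (E j) *: hessN p) + c *: (dot (E i) (E j) *: N))).
  apply: eq_wtrace => i j; rewrite Riem_conf_flat// NE !scale0r addr0 sub0r.
  rewrite scalerN opprK (smooth_schwarz N)// [in LHS]derive_grad//.
  exact: smooth_diff (smooth_derive N s_smooth).
rewrite wtraceD !wtraceZ wtraceD wtraceD !wtraceN.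
rewrite wtrace_dotE_r wtrace_hess !wtrace_first_form.
by apply/rowP => k; rewrite !mxE; ring.
Qed.

(* For n = 3 this is Ric(xi, xi) - |A|^2, with xi the unit normal and A the shape
   operator. *)
Definition biharmonic_operator (q : 'rV[R]_n) : R :=
  s q * (\sum_l partial l (partial l s) q + 'D_N ('D_N s) q / D)
  - 2 * dot (grad s q) (grad s q) - 2 * 'D_N s q ^+ 2 / D.

(** Exhibits the derivative of the tension field along [z] as a linear image of [z], so that the
    terms with the domain connection contract to zero by [wtrace_lin]. *)
Lemma scale_dot_mulmx (y z : 'rV[R]_2) (x : 'rV[R]_n) c :
  dot y z *: x + - c *: (z *m M) = z *m (y^T *m x - c *: M).
Proof.
rewrite mulmxBr mulmxA -scalemxAr scaleNr; congr (_ - _).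
rewrite [z *m _]mx11_scalar mul_scalar_mx; congr (_ *: _).
by rewrite mxE dotC; apply: eq_bigr => k _; rewrite mxE.
Qed.

Lemma bitension_regroup (a c d e t k : R) (x y z v : 'rV[R]_n) :
  a *: x - (c * t) *: y - (d * t + k * e) *: z - v =
  a *: x - t *: (c *: y) - (t *: (d *: z) + k *: (e *: z)) - v.
Proof. by rewrite !scalerA scalerDl (mulrC t) (mulrC t). Qed.

Lemma bitension_surface p : bitension g h phi p = w p *:
  ((s (phi p) * (\sum_i \sum_j invmx C i j * partial i (partial j K) p)
     + K p / s (phi p) * biharmonic_operator (phi p)) *: N
   - (2 * nd p) *: wtrace (invmx C) (fun i j => partial i K p *: E j)).
Proof.
rewrite /bitension trace_g_conformal// ?w_neq0// trace_g_conformal// ?w_neq0//.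
rewrite -scalerBr; congr (_ *: _).
pose Z i j := nabla g (frame i) (frame j) p.
have Z0 : wtrace (invmx C) Z = 0 by exact: wtrace_Gamma_g.
transitivity (wtrace (invmx C) (fun i j =>
   (partial i (partial j K) p *: nu p - (partial j K p * nd p) *: E i
     - (partial i K p * nd p + K p * dot (hessN p) (E i)) *: E j
     - (K p * nd p) *: Gamma h (phi p) (E i) (E j))
   - (Z i j *m ((grad K p)^T *m nu p - (K p * nd p) *: M)))
   - wtrace (invmx C)
      (fun i j => (K p * s (phi p)) *: Riem h (phi p) (E i) N (E j))).
  congr (_ - _); apply: eq_wtrace => i j.
    rewrite pull_nabla2_tension pull_nabla_tension; congr (_ - _).
    have dK : differentiable K p by exact: smooth_diff smooth_tension_coef.
    by rewrite (derive_grad _ dK) -scale_dot_mulmx.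
  rewrite !dmapE tension_surface (RiemZ s_smooth s_neq0).
  by rewrite [nu p]/(s (phi p) *: N) (RiemZ s_smooth s_neq0) scalerA.
rewrite wtraceD wtraceN wtrace_lin// subr0 wtraceZ.
transitivity ((\sum_i \sum_j invmx C i j * partial i (partial j K) p) *: nu p
  - nd p *: wtrace (invmx C) (fun i j => partial j K p *: E i)
  - (nd p *: wtrace (invmx C) (fun i j => partial i K p *: E j)
     + K p *: wtrace (invmx C) (fun i j => dot (hessN p) (E i) *: E j))
  - (K p * nd p) *: wtrace (invmx C) (fun i j => Gamma h (phi p) (E i) (E j))
  - (K p * s (phi p)) *: wtrace (invmx C)
      (fun i j => Riem h (phi p) (E i) N (E j))).
  congr (_ - _); rewrite -wtrace_scale -!wtraceZ -wtraceD -!wtraceN -!wtraceD.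
  apply: eq_wtrace => i j.
  exact: bitension_regroup.
(* Symmetry makes the two contractions of dK equal, whence the factor 2. The vector [hessN] occurs
   with coefficient -K from the second derivatives and +K from the curvature, and so disappears. *)
have Ci_sym : (invmx C)^T = invmx C by rewrite trmx_inv C_sym.
rewrite (wtrace_sym (fun i j => partial i K p *: E j) Ci_sym).
rewrite wtrace_dotE wtrace_Gamma_h wtrace_Riem /nu /biharmonic_operator.
have -> : dot (hessN p) N = 'D_N ('D_N s) (phi p).
  by rewrite -derive_grad//; exact: smooth_diff (smooth_derive N s_smooth).
rewrite -/(nd p) invfM.
move: (wtrace _ _) (hessN p) ('D_N ('D_N s) (phi p)) => W hN dNN.
move: (\sum_i _) (\sum_l _) (dot _ _) (nd p) (K p) => L tr gg m k.
have := s_neq0 (phi p); move: (s (phi p)) (D^-1) => t d t0.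
by apply/rowP => l; rewrite !mxE; field.
Qed.

Lemma wtrace_grad (u : 'rV[R]_2 -> R) p :
  wtrace (invmx C) (fun i j => partial i u p *: E j) = grad u p *m invmx C *m M.
Proof.
by rewrite -wtrace_mulmx; apply: eq_wtrace => i j; rewrite mxE row_E.
Qed.

(** * Normal and tangential parts of the biharmonic equation *)

Hypothesis D_gt0 : 0 < D.

(** Pairing with [N] isolates the normal coefficient; multiplying the remaining tangential part by
    the transpose of [M] produces [C], which undoes its inverse and recovers [x]. *)
Lemma normal_tangent_eq0 p (a : R) (x : 'rV[R]_2) :
  w p *: (a *: N - (2 * nd p) *: (x *m invmx C *m M)) = 0 <->
  a = 0 /\ nd p *: x = 0.
Proof.
split=> [/eqP|[-> nx]]; last first.
  by rewrite scale0r sub0r -scalerA !scalemxAl nx scaler0 !mul0mx oppr0 scaler0.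
rewrite scaler_eq0 (negPf (w_neq0 p)) /= => /eqP H.
have a0 : a = 0.
  have := congr1 (fun x => dot x N) H.
  rewrite dotDl dotZl -scaleNr dotZl normalN mulr0 addr0 -/D.
  rewrite [X in _ = X -> _]/dot big1 => [|i _]; last by rewrite mxE mul0r.
  by move/eqP; rewrite mulf_eq0 (gt_eqF D_gt0) orbF => /eqP.
split=> //; move: H; rewrite a0 scale0r sub0r => /(congr1 (fun x => x *m M^T)).
rewrite mul0mx mulNmx -scalemxAl -!mulmxA -/C mulmxA mulmxKV// => /eqP.
rewrite oppr_eq0 -scalerA scaler_eq0 pnatr_eq0 /= => /eqP.
exact.
Qed.

Lemma bitension_eq0 p : bitension g h phi p = 0 <->
  s (phi p) * (\sum_i \sum_j invmx C i j * partial i (partial j K) p)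
     + K p / s (phi p) * biharmonic_operator (phi p) = 0 /\
  nd p *: grad K p = 0.
Proof.
rewrite bitension_surface wtrace_grad; exact: normal_tangent_eq0.
Qed.

Lemma laplacian_constant p : (forall q, grad K q = 0) ->
  \sum_i \sum_j invmx C i j * partial i (partial j K) p = 0.
Proof.
move=> gK; apply: big1 => i _; apply: big1 => j _.
rewrite (_ : partial j K = cst 0) /partial ?derive_cst ?mulr0//.
by apply/funext => q; have /rowP/(_ j) := gK q; rewrite !mxE.
Qed.

Lemma tension_eq0 p : (tension g h phi p == 0) = (K p == 0).
Proof.
have N_neq0 : N != 0.
  apply/eqP => N0; move: D_gt0; rewrite /D N0 /dot big1 ?ltxx// => i _.
  by rewrite mxE mul0r.
rewrite tension_surface /nu !scaler_eq0.
by rewrite (negPf (s_neq0 _)) (negPf N_neq0) !orbF.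
Qed.

Lemma proper_biharmonic_surface : proper_biharmonic g h phi <->
  (forall p, biharmonic_operator (phi p) = 0) /\
  exists c : R, 0 < c /\
    forall p, nd p != 0 /\ f p = c * Num.sqrt D / `|nd p|.
Proof.
have sK := smooth_tension_coef.
have sqrtD_neq0 : Num.sqrt D != 0 by rewrite sqrtr_eq0 -ltNge.
have sqrtD2 : D = Num.sqrt D ^+ 2 by rewrite sqr_sqrtr// ltW.
split=> [[bih nharm]|[Q0 [c [c_gt0 fE]]]].
  (* Since [K] is a multiple of [nd], the tangential equation gives K grad K = 0 at every point,
     zeros of [nd] included; this makes K^2 constant on the whole domain. *)
  have KgK p : K p *: grad K p = 0.
    have /bitension_eq0[_ H] := bih p.
    by rewrite /K mulrA -scalerA H scaler0.
  have K2 p q : K p * K p = K q * K q.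
    apply: grad0_constant (smoothM sK sK) _ => r.
    by rewrite grad_sqr// -scalerA KgK scaler0.
  have [p0 Kp0] : exists p0, K p0 != 0.
    apply: contrapT => H; apply: nharm => p; apply/eqP; rewrite tension_eq0.
    by apply/negP => /negP Kp; apply: H; exists p.
  have K_neq0 p : K p != 0.
    have := K2 p p0; apply: contra_eqN => /eqP->.
    by rewrite mul0r eq_sym mulf_neq0.
  have gK p : grad K p = 0.
    by have /eqP := KgK p; rewrite scaler_eq0 (negPf (K_neq0 p)) => /eqP.
  split=> [p|].
    have /bitension_eq0[/eqP + _] := bih p.
    rewrite laplacian_constant// mulr0 add0r mulf_eq0 mulf_eq0 invr_eq0.
    by rewrite (negPf (K_neq0 p)) (negPf (s_neq0 _)) => /eqP.
  (* Solving K = (2/D) f nd for [f] gives f = |K| D / (2 |nd|); one factor sqrt D of [D] belongs to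
     the stated formula and the other goes into the constant. *)
  exists (`|K p0| * Num.sqrt D / 2); split=> [|p].
    by rewrite !mulr_gt0 ?normr_gt0// lt0r sqrtD_neq0 sqrtr_ge0.
  have nd_neq0 : nd p != 0.
    by have := K_neq0 p; rewrite /K !mulf_eq0 !negb_or => /andP[_ /andP[]].
  split=> //; rewrite (grad0_constant p0 p sK gK) /K !normrM.
  rewrite (gtr0_norm (f_gt0 p)) normr_nat normfV (gtr0_norm D_gt0).
  rewrite [in D^-1]sqrtD2; have : `|nd p| != 0 by rewrite normr_eq0.
  by move: `|nd p| (Num.sqrt D) sqrtD_neq0 => x y y0 x0; field; rewrite x0 y0.
(* Conversely the formula for [f] determines [K] only up to the sign of [nd], so constancy is again
   obtained first for K^2. *)
have KE p : K p * K p = 4 * c ^+ 2 / D.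
  have [n0 fp] := fE p; rewrite /K fp [in RHS]sqrtD2 [in 2 / D]sqrtD2.
  have n2 : nd p * nd p = `|nd p| * `|nd p|.
    by rewrite -!expr2 real_normK ?num_real.
  rewrite (_ : _ * _ = (2 / Num.sqrt D ^+ 2 * (c * Num.sqrt D / `|nd p|)) ^+ 2
    * (nd p * nd p)); last by ring.
  rewrite n2; have : `|nd p| != 0 by rewrite normr_eq0.
  by move: `|nd p| (Num.sqrt D) sqrtD_neq0 => x y y0 x0; field; rewrite x0 y0.
have K_neq0 p : K p != 0.
  have [n0 _] := fE p.
  by rewrite /K !mulf_neq0// ?invr_eq0 ?pnatr_eq0// gt_eqF.
have gK p : grad K p = 0.
  have : grad (fun q => K q * K q) p = 0.
    rewrite (_ : (fun q => _) = cst (4 * c ^+ 2 / D)); last first.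
      by apply/funext => q; rewrite KE.
    by apply/rowP => i; rewrite !mxE /partial derive_cst.
  rewrite grad_sqr// => /eqP.
  by rewrite scaler_eq0 mulf_eq0 (negPf (K_neq0 p)) pnatr_eq0 /= => /eqP.
split=> [p|harm].
  apply/bitension_eq0; split; last by rewrite gK scaler0.
  by rewrite laplacian_constant// Q0 !mulr0 addr0.
by have /eqP := harm 0; rewrite tension_eq0 (negPf (K_neq0 0)).
Qed.

(** * Induced metric, conformal factor and mean curvature *)

Lemma pullback_surface p : pullback h phi p = (s (phi p) ^+ 2)^-1 *: C.
Proof.
apply/matrixP => i j; rewrite mxE /inner !dmapE.
rewrite -scalemxAr mulmx1 -scalemxAl mxE [RHS]mxE; congr (_ * _).
by rewrite -dot_EE dot_mulmx.
Qed.

(** The pullback metric vanishes nowhere, so comparing it with lambda^2 f^-1 times itself forces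
    lambda^2 = f; positivity selects the root. *)
Lemma conformal_factor_surface lambda :
  conformal_factor (fun p => (f p)^-1 *: pullback h phi p) h phi lambda <->
  forall p, lambda p = Num.sqrt (f p).
Proof.
have C_neq0 : C != 0.
  by apply: contraTneq C_unit => ->; rewrite unitmxE det0 unitr0.
have P_neq0 p : pullback h phi p != 0.
  by rewrite pullback_surface scaler_eq0 invr_eq0 expf_eq0 /= (negPf (s_neq0 _)).
split=> [cf p|lE p]; last first.
  rewrite lE sqrtr_gt0 f_gt0; split=> //.
  by rewrite scalerA sqr_sqrtr ?divff ?scale1r ?gt_eqF ?ltW.
have [l_gt0 /eqP] := cf p.
rewrite -subr_eq0 -[X in X - _]scale1r scalerA -scalerBl scaler_eq0.
rewrite (negPf (P_neq0 p)) orbF subr_eq0 => /eqP l2.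
suff -> : f p = lambda p ^+ 2 by rewrite sqrtr_sqr gtr0_norm.
by rewrite -[LHS]mul1r l2 divfK// gt_eqF.
Qed.

(** The unit normal is [nu] divided by sqrt D, so by [pull_nabla_nu] the shape operator is a scalar
    matrix, and half its trace is that scalar. *)
Lemma mean_curvature_surface : mean_curvature h phi
  (fun p => (s (phi p) / Num.sqrt D) *: N) (fun p => nd p / Num.sqrt D).
Proof.
have sqrtD_neq0 : Num.sqrt D != 0 by rewrite sqrtr_eq0 -ltNge.
have innerE q (u v : 'rV[R]_n) : inner h q u v = (s q ^+ 2)^-1 * dot u v.
  rewrite /inner -scalemxAr mulmx1 -scalemxAl mxE; congr (_ * _).
  by rewrite -[u]mulmx1 dot_mulmx.
split=> [p|].
  split=> [|X]; rewrite innerE dotZl ?dmapE.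
    rewrite dotZr -/D -[X in _ * (_ * (_ * X))](sqr_sqrtr (ltW D_gt0)).
    have := s_neq0 (phi p).
    move: (s (phi p)) (Num.sqrt D) sqrtD_neq0 => x y y0 x0.
    by field; rewrite x0 y0.
  by rewrite dotC normalN !mulr0.
exists (fun p => (nd p / Num.sqrt D)%:M); split=> [X p|p]; last first.
  by rewrite mxtrace_scalar; field.
rewrite dmapE mul_mx_scalar -scalemxAl.
rewrite (_ : (fun q => _ *: N) = fun q => cst (Num.sqrt D)^-1 q *: nu q).
  have [Dnu _] := is_derive_nu p (X p).
  rewrite (pull_nabla_scale (is_derive_cst _ p (X p)) Dnu) pull_nabla_nu.
  by rewrite scale0r add0r scalerA mulrN scaleNr opprK mulrC.
by apply/funext => q; rewrite scalerA mulrC.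
Qed.

End AffineSurface.

(** * The graph of an affine function in coordinates *)

Lemma ord2P (i : 'I_2) : i = 0 \/ i = 1.
Proof.
by case: i => -[|[|//]] lt_i; [left|right]; apply/val_inj.
Qed.

Lemma ord3P (i : 'I_3) : [\/ i = 0, i = 1 | i = 2].
Proof.
by case: i => -[|[|[|//]]] lt_i;
  [constructor 1|constructor 2|constructor 3]; apply/val_inj.
Qed.

Lemma sum_ord2 {V : zmodType} (F : 'I_2 -> V) : \sum_i F i = F 0 + F 1.
Proof.
rewrite !big_ord_recl big_ord0 addr0; congr (_ + _); congr F; exact/val_inj.
Qed.

Lemma sum_ord3 {V : zmodType} (F : 'I_3 -> V) : \sum_i F i = F 0 + F 1 + F 2.
Proof.
rewrite !big_ord_recl big_ord0 addr0 addrA; congr (_ + _ + _);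
  congr F; exact/val_inj.
Qed.

Section GraphPlane.
Context {R : realType} (a1 a2 a3 : R).

Definition graph_mx : 'M[R]_(2, 3) :=
  \matrix_i (if i == 0 then vec3 1 0 a1 else vec3 0 1 a2).
Definition graph_normal : 'rV[R]_3 := vec3 (- a1) (- a2) 1.
Local Notation M := graph_mx.
Local Notation N := graph_normal.
Local Notation D := (1 + a1 ^+ 2 + a2 ^+ 2).

Lemma graph_planeE p : graph_plane a1 a2 a3 p = p *m M + vec3 0 0 a3.
Proof.
apply/rowP => k; rewrite !mxE sum_ord2 !mxE /=.
by case: (ord3P k) => -> /=; ring.
Qed.

Lemma dot_normal : dot N N = D.
Proof. by rewrite /dot sum_ord3 !mxE /=; ring. Qed.

Lemma dot_tangent_normal v : dot (v *m M) N = 0.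
Proof. by rewrite /dot sum_ord3 !mxE !sum_ord2 !mxE /=; ring. Qed.

Lemma graph_D_gt0 : 0 < D.
Proof. by rewrite -addrA ltr_pwDl// addr_ge0// sqr_ge0. Qed.

(** The adjugate of the first fundamental form divided by its determinant, which equals 1 + a1^2 +
    a2^2. *)
Definition graph_inv : 'M[R]_2 := D^-1 *: \matrix_(i, j)
  (if i == j then (if i == 0 then 1 + a2 ^+ 2 else 1 + a1 ^+ 2) else - (a1 * a2)).

Lemma graph_invP : M *m M^T *m graph_inv = 1%:M.
Proof.
have D0 := lt0r_neq0 graph_D_gt0.
apply/matrixP => i j; rewrite !mxE sum_ord2 !mxE !sum_ord3 !mxE.
by case: (ord2P i) (ord2P j) => -> [] -> /=; rewrite ?mxE /=; field.
Qed.

Lemma graph_unit : M *m M^T \in unitmx.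
Proof. by have [] := mulmx1_unit graph_invP. Qed.

Lemma graph_invmx : invmx (M *m M^T) = graph_inv.
Proof. by rewrite -[RHS](mulKmx graph_unit) graph_invP mulmx1. Qed.

Lemma graph_proj :
  M^T *m invmx (M *m M^T) *m M = 1%:M - (dot N N)^-1 *: (N^T *m N).
Proof.
have D0 := lt0r_neq0 graph_D_gt0.
rewrite graph_invmx dot_normal.
apply/matrixP => i j; rewrite !mxE sum_ord2 !mxE !sum_ord2 big_ord1 !mxE.
by case: (ord3P i) (ord3P j) => -> [] -> /=; rewrite ?mxE /=; field.
Qed.

Lemma derive_graph_normal (u : 'rV[R]_3 -> R) q : smooth u ->
  'D_N u q = - a1 * pdx u q - a2 * pdy u q + pdz u q.
Proof.
move=> su; rewrite derive_grad; last exact: smooth_diff.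
by rewrite /dot sum_ord3 !mxE /= /pdx /pdy /pdz; ring.
Qed.

(** The values of the derivatives are treated as independent reals, making the expansion a rational
    identity; for example 1 + a1^2 / D supplies the coefficient of the xx term. *)
Lemma operator_expansion
    (t lap gg n nn nx ny nz x y z xx yy zz xy xz yz yx zx zy : R) :
  lap = xx + yy + zz -> gg = x ^+ 2 + y ^+ 2 + z ^+ 2 ->
  n = - a1 * x - a2 * y + z -> nn = - a1 * nx - a2 * ny + nz ->
  nx = - a1 * xx - a2 * xy + xz -> ny = - a1 * yx - a2 * yy + yz ->
  nz = - a1 * zx - a2 * zy + zz -> yx = xy -> zx = xz -> zy = yz ->
  t * (lap + nn / D) - 2 * gg - 2 * n ^+ 2 / D =
    (1 + 2 * a1 ^+ 2 + a2 ^+ 2) / D * (t * xx - 2 * x ^+ 2)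
  + (1 + a1 ^+ 2 + 2 * a2 ^+ 2) / D * (t * yy - 2 * y ^+ 2)
  + (2 + a1 ^+ 2 + a2 ^+ 2) / D * (t * zz - 2 * z ^+ 2)
  + 2 * a1 * a2 / D * (t * xy - 2 * x * y)
  - 2 * a1 / D * (t * xz - 2 * x * z) - 2 * a2 / D * (t * yz - 2 * y * z).
Proof.
have D0 := lt0r_neq0 graph_D_gt0.
by move=> -> -> -> -> -> -> -> -> -> ->; field.
Qed.

Lemma biharmonic_operator_graph (s : 'rV[R]_3 -> R) q : smooth s ->
  biharmonic_operator s N q =
    (1 + 2 * a1 ^+ 2 + a2 ^+ 2) / D * (s q * pdx (pdx s) q - 2 * (pdx s q) ^+ 2)
  + (1 + a1 ^+ 2 + 2 * a2 ^+ 2) / D * (s q * pdy (pdy s) q - 2 * (pdy s q) ^+ 2)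
  + (2 + a1 ^+ 2 + a2 ^+ 2) / D * (s q * pdz (pdz s) q - 2 * (pdz s q) ^+ 2)
  + 2 * a1 * a2 / D * (s q * pdy (pdx s) q - 2 * pdx s q * pdy s q)
  - 2 * a1 / D * (s q * pdz (pdx s) q - 2 * pdx s q * pdz s q)
  - 2 * a2 / D * (s q * pdz (pdy s) q - 2 * pdy s q * pdz s q).
Proof.
move=> ss; have lap : \sum_l partial l (partial l s) q =
    pdx (pdx s) q + pdy (pdy s) q + pdz (pdz s) q by exact: sum_ord3.
have gg : dot (grad s q) (grad s q) =
    pdx s q ^+ 2 + pdy s q ^+ 2 + pdz s q ^+ 2.
  by rewrite /dot sum_ord3 !mxE.
(* As [N] is constant, ['D_N] commutes with partial derivatives, which expands Hess s(N, .) into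
   coordinate second derivatives. *)
have comm i : partial i ('D_N s) q = - a1 * pdx (partial i s) q
    - a2 * pdy (partial i s) q + pdz (partial i s) q.
  exact: etrans (smooth_schwarz _ _ _ ss)
    (derive_graph_normal q (smooth_partial i ss)).
have xy : pdx (pdy s) q = pdy (pdx s) q by exact: smooth_schwarz.
have xz : pdx (pdz s) q = pdz (pdx s) q by exact: smooth_schwarz.
have yz : pdy (pdz s) q = pdz (pdy s) q by exact: smooth_schwarz.
have NN := derive_graph_normal q (smooth_derive N ss).
rewrite /biharmonic_operator dot_normal.
exact: operator_expansion lap gg (derive_graph_normal q ss) NN
  (comm 0) (comm 1) (comm 2) xy xz yz.
Qed.

End GraphPlane.

(** * Specialisation of the affine surface to the graph *)

Theorem proposition2p3 (R : realType) (F beta : 'rV[R]_3 -> R)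
    (f : 'rV[R]_2 -> R) (a1 a2 a3 : R)
    (F_smooth : smooth F) (beta_smooth : smooth beta) (f_smooth : smooth f)
    (F_gt0 : forall q, 0 < F q) (beta_gt0 : forall q, 0 < beta q)
    (f_gt0 : forall p, 0 < f p) :
  let phi := graph_plane a1 a2 a3 in
  let h0 : metric R 3 := fun q => (F q) ^- 2 *: 1%:M in
  let h : metric R 3 := fun q => (beta q) ^- 2 *: h0 q in
  let gbar : metric R 2 := fun p => (f p)^-1 *: pullback h phi p in
  let s := fun q => F q * beta q in
  let D := 1 + a1 ^+ 2 + a2 ^+ 2 in
  let ds_normal := fun q => - a1 * pdx s q - a2 * pdy s q + pdz s q in
  let xi := fun p => (s (phi p) / Num.sqrt D) *: vec3 (- a1) (- a2) 1 in
  (proper_biharmonic gbar h phi <->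
    (forall p, let q := phi p in
       (1 + 2 * a1 ^+ 2 + a2 ^+ 2) / D
         * (s q * pdx (pdx s) q - 2 * (pdx s q) ^+ 2)
       + (1 + a1 ^+ 2 + 2 * a2 ^+ 2) / D
         * (s q * pdy (pdy s) q - 2 * (pdy s q) ^+ 2)
       + (2 + a1 ^+ 2 + a2 ^+ 2) / D
         * (s q * pdz (pdz s) q - 2 * (pdz s q) ^+ 2)
       + 2 * a1 * a2 / D
         * (s q * pdy (pdx s) q - 2 * pdx s q * pdy s q)
       - 2 * a1 / D
         * (s q * pdz (pdx s) q - 2 * pdx s q * pdz s q)
       - 2 * a2 / D
         * (s q * pdz (pdy s) q - 2 * pdy s q * pdz s q) = 0)
    /\
    (exists c : R, 0 < c /\
       forall p, ds_normal (phi p) != 0 /\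
         f p = c * Num.sqrt D / `|ds_normal (phi p)|))
  /\
  (forall lambda : 'rV[R]_2 -> R,
     conformal_factor gbar h phi lambda <->
     forall p, lambda p = Num.sqrt (f p))
  /\
  mean_curvature h phi xi (fun p => ds_normal (phi p) / Num.sqrt D).
Proof.
move=> phi h0 h gbar s D ds_normal xi.
have ss : smooth s by exact: smoothM.
have s_neq0 q : s q != 0 by rewrite mulf_neq0 ?lt0r_neq0.
pose M := graph_mx a1 a2; pose N := graph_normal a1 a2; pose b := vec3 0 0 a3.
have phiE : phi = fun p => p *m M + b by apply/funext => p; exact: graph_planeE.
have hE : h = conf_flat s.
  apply/funext => q; rewrite /h /h0 /conf_flat scalerA; congr (_ *: _).
  by rewrite [LHS]mulrC -invfM -exprMn.
have normalN : forall v, dot (v *m M) N = 0 by exact: dot_tangent_normal.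
have C_unit : M *m M^T \in unitmx by exact: graph_unit.
have proj := graph_proj a1 a2.
have DE : dot N N = D by exact: dot_normal.
have D_gt0 : 0 < dot N N by rewrite DE; exact: graph_D_gt0.
have nE : ds_normal = 'D_N s.
  by apply/funext => q; rewrite derive_graph_normal.
(* The domain metric is brought to the form w^-1 C with w = f s^2, as required by the general result
   on affine surfaces. *)
have gbarE : gbar = fun p => (f p * s (p *m M + b) ^+ 2)^-1 *: (M *m M^T).
  by apply/funext => p; rewrite /gbar hE phiE pullback_surface scalerA -invfM.
rewrite nE /xi -DE; split; last split.
- rewrite gbarE hE phiE.
  have -> := proper_biharmonic_surface b ss s_neq0 normalN C_unit proj
    f_smooth f_gt0 D_gt0.
  split=> -[Q c]; split=> // p.
    by have := Q p; rewrite biharmonic_operator_graph// DE.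
  by rewrite biharmonic_operator_graph//; have := Q p; rewrite DE.
- move=> lambda; rewrite /gbar hE phiE.
  exact: (conformal_factor_surface b s_neq0 C_unit f_gt0).
- rewrite hE phiE.
  exact: (mean_curvature_surface b ss s_neq0 normalN D_gt0).
Qed.
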